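(* Let $\Omega$ be a compact metric space and $K$ a kernel on $\Omega\times\Omega$. Suppose that $\mu\in\mathbb P(\Omega)$ is a (directional) local minimizer of $I_K$ in $\mathbb P(\Omega)$ and that either of the following two conditions holds: (1) the measure $\mu$ is $K$-invariant, i.e. $U_K^\mu(x)=I_K(\mu)$ for all $x\in\Omega$; (2) $K$ is conditionally positive definite. Then $\mu$ is a global minimizer of $I_K$ over $\mathbb P(\Omega)$.
   Context: A kernel on $\Omega\times\Omega$ is a continuous symmetric function $K:\Omega\times\Omega\to\mathbb R$. $\mathbb P(\Omega)$ is the set of Borel probability measures on $\Omega$. $I_K(\mu)=\int_\Omega\int_\Omega K(x,y)\,d\mu(x)\,d\mu(y)$ and $U_K^\mu(x)=\int_\Omega K(x,y)\,d\mu(y)$. $K$ is conditionally positive definite if $I_K(\nu)\ge0$ for every finite regular signed Borel measure $\nu$ on $\Omega$ with $\nu(\Omega)=0$. $\mu\in\mathbb P(\Omega)$ is a (directional) local minimizer of $I_K$ in $\mathbb P(\Omega)$ if for each $\nu\in\mathbb P(\Omega)$ there exists $\tau_\nu\in(0,1]$ such that $I_K((1-t)\mu+t\nu)\ge I_K(\mu)$ for all $t\in[0,\tau_\nu]$. *)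

(* Defs.v *)
From HB Require Import structures.
From mathcomp Require Import all_boot all_order all_algebra.
From mathcomp Require Import all_classical all_reals all_analysis.

Set Implicit Arguments.
Unset Strict Implicit.
Unset Printing Implicit Defensive.

Import Order.TTheory GRing.Theory Num.Theory.
Import numFieldNormedType.Exports.

Local Open Scope classical_set_scope.
Local Open Scope ring_scope.

(* Measurable types are pointed in the library, so the Borel sigma-algebra is
   only available on nonempty metric spaces. *)
#[short(type="pointedMetricType")]
HB.structure Definition PointedMetric (R : numDomainType) :=
  {M of Metric R M & Pointed M}.

Notation borel Omega := (g_sigma_algebraType (@open Omega)).

Section energy.
Context {R : realType} {Omega : pointedMetricType R}.
Implicit Types (K : Omega -> Omega -> R)
  (nu : {charge set (borel Omega) -> \bar R}).

Definition kernel_function K :=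
  continuous (fun z : Omega * Omega => K z.1 z.2) /\
  forall x y, K x y = K y x.

Definition potential K (mu : {measure set (borel Omega) -> \bar R})
    (x : borel Omega) : R :=
  \int[mu]_(y in [set: borel Omega]) K x y.

Definition energy K (mu : {measure set (borel Omega) -> \bar R}) : R :=
  \int[mu]_(x in [set: borel Omega]) potential K mu x.

(* A chosen Hahn decomposition of nu; the Jordan parts of nu do not depend on
   the choice. *)
Definition hahn_pos nu : set (borel Omega) := sval (cid (Hahn_decomposition nu)).

Definition hahn_neg nu : set (borel Omega) :=
  sval (cid (svalP (cid (Hahn_decomposition nu)))).

Definition hahnP nu : hahn_decomposition nu (hahn_pos nu) (hahn_neg nu) :=
  svalP (cid (svalP (cid (Hahn_decomposition nu)))).

Definition charge_integral nu (f : borel Omega -> R) : R :=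
  \int[jordan_pos (hahnP nu)]_(x in [set: borel Omega]) f x -
  \int[jordan_neg (hahnP nu)]_(x in [set: borel Omega]) f x.

Definition charge_energy K nu : R :=
  charge_integral nu (fun x => charge_integral nu (fun y => K x y)).

Definition abs_charge nu (A : set (borel Omega)) : \bar R :=
  charge_variation (hahnP nu) A.

Definition regular_charge nu :=
  forall A : set (borel Omega), measurable A ->
    abs_charge nu A = ereal_inf [set abs_charge nu U |
      U in [set U : set Omega | open U /\ A `<=` U]] /\
    abs_charge nu A = ereal_sup [set abs_charge nu C |
      C in [set C : set Omega | compact C /\ C `<=` A]].

Definition conditionally_positive_definite K :=
  forall nu, regular_charge nu -> nu [set: borel Omega] = 0%E ->
    0 <= charge_energy K nu.

Definition invariant_measure K (mu : probability (borel Omega) R) :=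
  forall x : Omega, potential K mu x = energy K mu.

(* (1 - t) mu + t nu *)
Definition mixture (t : {i01 R}) (mu nu : probability (borel Omega) R) :
    {measure set (borel Omega) -> \bar R} :=
  measure_add (mscale (1 - t%:num)%:nng mu) (mscale t%:num%:nng nu).

Definition local_minimizer K (mu : probability (borel Omega) R) :=
  forall nu : probability (borel Omega) R,
    exists tau : R, [/\ 0 < tau, tau <= 1 &
      forall t : {i01 R}, t%:num <= tau ->
        energy K mu <= energy K (mixture t mu nu)].

Definition global_minimizer K (mu : probability (borel Omega) R) :=
  forall nu : probability (borel Omega) R, energy K mu <= energy K nu.

End energy.

(* Main.v *)
Require Import Defs.
From mathcomp Require Import all_boot all_order all_algebra.
From mathcomp Require Import all_classical all_reals all_analysis.
From mathcomp Require Import measurable_realfun ring lra.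

Set Implicit Arguments.
Unset Strict Implicit.
Unset Printing Implicit Defensive.

Import Order.TTheory GRing.Theory Num.Theory.
Import numFieldNormedType.Exports.

Local Open Scope classical_set_scope.
Local Open Scope ring_scope.

(** Write E for the energy and M(nu, mu) for the mutual energy, the integral of
    the potential of mu against nu.  Fubini's theorem and the symmetry of K make
    M symmetric, so the energy is a quadratic function along the segment from mu
    to nu:

      E((1 - t) mu + t nu) - E(mu) = 2 t (M(nu, mu) - E(mu)) + t^2 Q,
      where Q = E(nu) - 2 M(nu, mu) + E(mu)

    ([energy_mixture], [local_minimizer_quadratic]).  Local minimality says that
    the right-hand side is nonnegative for all small t >= 0.

    If mu is K-invariant, integrating its constant potential against nu gives
    M(nu, mu) = E(mu).  The linear term vanishes and Q reduces to E(nu) - E(mu),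
    which is nonnegative as soon as one t > 0 is allowed.

    If K is conditionally positive definite, the linear coefficient is
    nonnegative because it dominates the quadratic term near 0
    ([ge0_of_quadratic_near0]).  Moreover Q is the energy of the signed measure
    nu - mu, whose total mass is 0, so Q >= 0.  Adding up,
    E(nu) >= 2 M(nu, mu) - E(mu) >= E(mu).

    Three points need work.  Fubini's theorem asks that K be measurable for the
    product of the Borel sigma-algebras, which contains the open sets of
    Omega * Omega because Omega is second countable ([open_borel_prod]).
    Conditional positive definiteness only speaks of regular signed measures, so
    signed measures on a compact metric space have to be shown regular
    ([regular_charge_compact]).  Finally, integrals against nu - mu are defined by
    its Jordan parts and have to be rewritten as differences of integrals against
    nu and mu ([charge_integral_sub]). *)

(** * Integration of bounded measurable functions *)

(** On a compact space all the integrands at hand are of this kind; they are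
    integrable for every finite measure and are stable under linear combinations,
    which spares all the integrability side conditions below. *)
Definition bounded_measurable d (T : measurableType d) (R : realType)
    (f : T -> R) :=
  measurable_fun [set: T] f /\ exists M, forall x, `|f x| <= M.

Section bounded_integration.
Context d (T : measurableType d) (R : realType).
Implicit Types (m : {finite_measure set T -> \bar R}) (f g : T -> R).

Lemma bounded_measurable_integrable m f :
  bounded_measurable f -> m.-integrable [set: T] (EFin \o f).
Proof.
move=> [mf [M fM]]; apply: measurable_bounded_integrable => //.
  by rewrite -ge0_fin_numE// fin_num_measure.
by exists M; split; rewrite ?num_real// => N MN x _;
  exact: le_trans (fM x) (ltW MN).
Qed.

Lemma bounded_measurableZ k f :
  bounded_measurable f -> bounded_measurable (fun x => k * f x).
Proof.
move=> [mf [M fM]]; split; first exact: measurable_funM.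
by exists (`|k| * M) => x; rewrite normrM ler_wpM2l.
Qed.

Lemma bounded_measurableD f g : bounded_measurable f -> bounded_measurable g ->
  bounded_measurable (fun x => f x + g x).
Proof.
move=> [mf [M fM]] [mg [N gN]]; split; first exact: measurable_funD.
by exists (M + N) => x; rewrite (le_trans (ler_normD _ _))// lerD.
Qed.

Lemma Rintegral_lincomb m f g (a b : R) :
  bounded_measurable f -> bounded_measurable g ->
  \int[m]_x (a * f x + b * g x) = a * \int[m]_x f x + b * \int[m]_x g x.
Proof.
move=> bf bg; rewrite RintegralD//; last 2 first.
- exact/bounded_measurable_integrable/bounded_measurableZ.
- exact/bounded_measurable_integrable/bounded_measurableZ.
by rewrite !RintegralZl//; exact: bounded_measurable_integrable.
Qed.

(** Homogeneity in the measure holds for every nonnegative integrand; subtracting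
    the positive and negative parts is legitimate as both have a finite
    integral. *)
Lemma Rintegral_mscale m (k : {nonneg R}) f : bounded_measurable f ->
  \int[mscale k m]_x f x = k%:num * \int[m]_x f x.
Proof.
move=> bf; have intf := bounded_measurable_integrable m bf.
have /integrableP[mf _] := intf; have fif := integrable_fin_num measurableT intf.
have fip := integrable_pos_fin_num measurableT intf.
have fin := integrable_neg_fin_num measurableT intf.
rewrite /Rintegral integralE !ge0_integral_mscale//;
  [|exact: measurable_funeneg|exact: measurable_funepos].
by rewrite -muleBr ?fin_num_adde_defr// -integralE fineM.
Qed.

Lemma Rintegral_measure_add m1 m2 f : bounded_measurable f ->
  \int[measure_add m1 m2]_x f x = \int[m1]_x f x + \int[m2]_x f x.
Proof.
move=> bf; have i1 := bounded_measurable_integrable m1 bf.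
have i2 := bounded_measurable_integrable m2 bf.
rewrite /Rintegral integral_measure_add// fineD//; exact: integrable_fin_num.
Qed.

End bounded_integration.

(** * The Borel sigma-algebra and its product *)

Lemma open_borel (T : ptopologicalType) (U : set T) :
  open U -> measurable (U : set (borel T)).
Proof. exact: sub_sigma_algebra. Qed.

Lemma closed_borel (T : ptopologicalType) (F : set T) :
  closed F -> measurable (F : set (borel T)).
Proof.
move=> cF; rewrite -[X in measurable X]setCK.
by apply: measurableC; apply: open_borel; exact: closed_openC.
Qed.

(** An open set of the product is the union of the open rectangles that it
    contains; those with sides in a countable basis suffice, and there are only
    countably many of them. *)
Lemma open_borel_prod (T : ptopologicalType) (U : set (T * T)) :
  @second_countable T -> open U ->
  measurable (U : set (borel T * borel T)).
Proof.
move=> [B cB [Bo Bb]] oU.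
have -> : U =
    \bigcup_(b : {b : set T * set T | (B `*` B) b /\ b.1 `*` b.2 `<=` U})
      ((sval b).1 `*` (sval b).2).
  apply/seteqP; split => [[x y] Uxy|]; last by move=> z [[b [Bbb bU]] _ /bU].
  move: oU; rewrite openE => /(_ _ Uxy) [[P Q] [/= xP yQ] PQU].
  have [V [BV Vx] VP] := Bb x _ xP; have [W [BW Wy] WQ] := Bb y _ yQ.
  have VWU : V `*` W `<=` U.
    by move=> [a b] [/= Va Wb]; apply: PQU; split; [exact: VP|exact: WQ].
  by exists (exist _ (V, W) (conj (conj BV BW) VWU)).
apply: countable_bigcupT_measurable => [|[[V W] [[/= BV BW] _]]]; last first.
  by apply: measurableX; apply: open_borel; exact: Bo.
have /countable_injP[f injf] := countableX cB cB.
apply/countable_injP; exists (fun s => f (sval s)).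
move=> [b [Bb1 bU1]] [c [Bc1 cU1]] _ _ /= fbc.
by apply: eq_exist; apply: injf; rewrite ?inE.
Qed.

Lemma continuous_borel_prod_measurable (R : realType) (T : ptopologicalType)
    (f : T * T -> R) : @second_countable T -> continuous f ->
  measurable_fun [set: borel T * borel T] f.
Proof.
move=> cT /continuousP cf; apply: (measurability _ (RGenOpens.measurableE R)).
move=> _ [_ [a [b ->] <-]]; rewrite setTI; apply: open_borel_prod => //.
exact/cf/interval_open.
Qed.

(** * Mutual energy *)

Lemma kernel_measurable (R : realType) (Omega : pointedMetricType R)
    (K : Omega -> Omega -> R) : compact [set: Omega] -> kernel_function K ->
  measurable_fun [set: borel Omega * borel Omega] (fun z => K z.1 z.2).
Proof.
move=> Oc [cK _]; apply: (@continuous_borel_prod_measurable R Omega) => //.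
exact: compact_second_countable Oc.
Qed.

Lemma kernel_bounded (R : realType) (Omega : pointedMetricType R)
    (K : Omega -> Omega -> R) : compact [set: Omega] -> kernel_function K ->
  exists M, forall x y, `|K x y| <= M.
Proof.
move=> Oc [cK _].
have : compact ((fun z => K z.1 z.2) @` [set: Omega * Omega]).
  apply: (continuous_compact (continuous_subspaceT cK)).
  by rewrite -setXTT; exact: compact_setX.
move=> /compact_bounded [M [_ KM]]; exists (M + 1) => x y.
by apply: (KM (M + 1)); [rewrite ltrDl|exists (x, y)].
Qed.

Section mutual_energy.
Context {R : realType} {Omega : pointedMetricType R}.
Variable K : Omega -> Omega -> R.
Hypothesis Omega_compact : compact [set: Omega].
Hypothesis K_kernel : kernel_function K.
Implicit Types m : {finite_measure set (borel Omega) -> \bar R}.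

Definition mutual_energy (m1 m2 : {measure set (borel Omega) -> \bar R}) : R :=
  \int[m1]_(x in [set: borel Omega]) potential K m2 x.

Lemma bounded_measurable_kernel (x : borel Omega) :
  bounded_measurable (fun y : borel Omega => K x y).
Proof.
have mK := kernel_measurable Omega_compact K_kernel.
have [M KM] := kernel_bounded Omega_compact K_kernel.
split; last by exists M => y; exact: KM.
exact: (measurableT_comp mK (pair1_measurable x)).
Qed.

Lemma integrable_kernel m1 m2 : (m1 \x m2)%E.-integrable
  [set: borel Omega * borel Omega] (fun z => (K z.1 z.2)%:E).
Proof.
have mK := kernel_measurable Omega_compact K_kernel.
have [M KM] := kernel_bounded Omega_compact K_kernel.
apply: measurable_bounded_integrable => //.
  rewrite [X in (X < _)%E](_ : _ = (m1 setT * m2 setT)%E); last first.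
    by rewrite -setXTT; exact: product_measure1E.
  by rewrite -ge0_fin_numE ?mule_ge0// fin_numM// fin_num_measure.
by exists M; split; rewrite ?num_real// => N MN z _;
  exact: le_trans (KM z.1 z.2) (ltW MN).
Qed.

(** The potential is a partial integral of K, measurable by Fubini's theorem for
    the product of m with itself. *)
Lemma bounded_measurable_potential m : bounded_measurable (potential K m).
Proof.
have [M KM] := kernel_bounded Omega_compact K_kernel.
split.
  have := measurable_fubini_F (integrable_kernel m m).
  exact: (measurableT_comp (fine_measurable measurableT)).
exists (M * fine (m setT)) => x.
have iK := bounded_measurable_integrable m (bounded_measurable_kernel x).
rewrite (le_trans (le_normr_Rintegral _ iK))// -Rintegral_cst//.
apply: le_Rintegral => //.
- exact: integrable_norm.
- exact: finite_measure_integrable_cst.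
Qed.

Lemma mutual_energyC m1 m2 : mutual_energy m1 m2 = mutual_energy m2 m1.
Proof.
have fin m (x : borel Omega) : (\int[m]_y (K x y)%:E)%E \is a fin_num.
  apply: integrable_fin_num => //; apply: bounded_measurable_integrable.
  exact: bounded_measurable_kernel.
congr fine.
transitivity (\int[m1]_x \int[m2]_y (K x y)%:E)%E.
  apply: eq_integral => x _.
  by rewrite /potential /Rintegral/= fineK//; exact: fin.
rewrite (Fubini (integrable_kernel m1 m2)).
apply: eq_integral => y _; rewrite /potential /Rintegral/= fineK; last exact: fin.
by apply: eq_integral => x _; rewrite K_kernel.2.
Qed.

Lemma potential_mixture (t : {i01 R}) (mu nu : probability (borel Omega) R) x :
  potential K (mixture t mu nu) x =
  (1 - t%:num) * potential K mu x + t%:num * potential K nu x.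
Proof.
have bK := bounded_measurable_kernel x.
by rewrite /potential Rintegral_measure_add// !Rintegral_mscale.
Qed.

(** The energy is the quadratic form of the bilinear mutual energy; the two cross
    terms of the expansion agree by symmetry. *)
Lemma energy_mixture (t : {i01 R}) (mu nu : probability (borel Omega) R) :
  energy K (mixture t mu nu) =
  (1 - t%:num) ^+ 2 * energy K mu +
  2 * t%:num * (1 - t%:num) * mutual_energy nu mu + t%:num ^+ 2 * energy K nu.
Proof.
have bmu : bounded_measurable (potential K mu) := bounded_measurable_potential mu.
have bnu : bounded_measurable (potential K nu) := bounded_measurable_potential nu.
have bp : bounded_measurable
    (fun x => (1 - t%:num) * potential K mu x + t%:num * potential K nu x).
  by apply: bounded_measurableD; exact: bounded_measurableZ.
rewrite /energy; under eq_Rintegral do rewrite potential_mixture.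
rewrite Rintegral_measure_add// !Rintegral_mscale// !Rintegral_lincomb//.
rewrite -/(mutual_energy mu nu) -/(mutual_energy nu mu).
rewrite (mutual_energyC mu nu) /=; ring.
Qed.

End mutual_energy.

(** * Regularity of finite Borel measures *)

Lemma measure_bigcap_lt d (T : measurableType d) (R : realType)
    (m : {measure set T -> \bar R}) (B : (set T)^nat) (e : \bar R) :
  (m setT < +oo)%E -> (forall k, measurable (B k)) -> nonincreasing_seq B ->
  (m (\bigcap_k B k) < e)%E -> exists k, (m (B k) < e)%E.
Proof.
move=> m_fin mB niB mBe.
have cvgB : m \o B @ \oo --> m (\bigcap_k B k).
  apply: nonincreasing_cvg_mu => //; last exact: bigcapT_measurable.
  by apply: le_lt_trans m_fin; rewrite le_measure ?inE.
have [k _ /(_ k (leqnn k)) mBk] := cvgB _ (open_ereal_lt' mBe).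
by exists k.
Qed.

Section regularity.
Context {R : realType} {Omega : pointedMetricType R}.
Variable m : {measure set (borel Omega) -> \bar R}.
Hypothesis m_fin : (m setT < +oo)%E.

(** Approximating from both sides at once makes the property visibly stable under
    complements, which turns the sets with this property into a sigma-algebra. *)
Definition closed_open_approx (A : set Omega) := forall e : R, 0 < e ->
  exists F U : set Omega, [/\ closed F, open U, F `<=` A, A `<=` U &
    (m ((U `\` F) : set (borel Omega)) < e%:E)%E].

(** An open set is exhausted by closed sets: remove from it the points closer than
    1 / (k + 1) to its complement.  What is removed decreases to the empty set. *)
Lemma open_approx (U : set Omega) : open U -> closed_open_approx U.
Proof.
move=> oU e e0.
(* Taking interiors makes [G n] open without having to show that balls are. *)
pose G n : set Omega := \bigcup_(y in ~` U) (ball y (n.+1%:R^-1 : R))^°.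
have oG n : open (G n) by apply: bigcup_open => y _; exact: open_interior.
have mUG n : measurable ((U `&` G n) : set (borel Omega)).
  by apply: open_borel; exact: openI.
have [k mk] : exists k, (m ((U `&` G k) : set (borel Omega)) < e%:E)%E.
  apply: measure_bigcap_lt => //.
    move=> i j ij; apply/subsetPset => x [Ux [y Uy xy]]; split => //.
    exists y => //; apply: interiorS xy; apply: le_ball.
    by rewrite lef_pV2 ?posrE// ler_nat.
  rewrite (_ : \bigcap_k _ = set0) ?measure0 ?lte_fin//.
  apply/seteqP; split => // x Gx.
  have [Ux _] := Gx 0%N I.
  have /nbhs_ballP[r /= r0 xrU] : nbhs x U by exact: open_nbhs_nbhs.
  have [k kr] : exists k : nat, k.+1%:R^-1 < r.
    have [k _ /(_ k (leqnn k))] := near_infty_natSinv_lt (PosNum r0).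
    by exists k.
  have [_ [y Uy /interior_subset /ball_sym xy]] := Gx k I.
  by apply: Uy; apply: xrU; exact: le_ball (ltW kr) _ xy.
exists (~` G k), U; split => //; first exact: open_closedC.
  move=> x Gx; apply: contrapT => Ux; apply: Gx; exists x => //.
  exact: nbhsx_ballx.
by rewrite setDE setCK.
Qed.

Lemma setC_approx (A : set Omega) :
  closed_open_approx A -> closed_open_approx (~` A).
Proof.
move=> aA e e0; have [F [U [cF oU FA AU mUF]]] := aA e e0.
exists (~` U), (~` F); split.
- exact: open_closedC.
- exact: closed_openC.
- exact: subsetC.
- exact: subsetC.
- by rewrite setDE setCK setIC -setDE.
Qed.

(** The k-th set is approximated up to e / 2^(k + 2), hence the union up to e / 2.
    The union of the inner closed sets need not be closed, but by continuity from
    above of the measure finitely many of them lose less than another e / 2. *)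
Lemma bigcup_approx (A : (set Omega)^nat) :
  (forall k, closed_open_approx (A k)) -> closed_open_approx (\bigcup_k A k).
Proof.
move=> aA e e0.
have e20 : 0 < e / 2 by rewrite divr_gt0.
have /choice[FU FUP] : forall k, exists FU : set Omega * set Omega,
    [/\ closed FU.1, open FU.2, FU.1 `<=` A k, A k `<=` FU.2 &
      (m ((FU.2 `\` FU.1) : set (borel Omega)) < (e / 2 / (2 ^ k.+1)%:R)%:E)%E].
  move=> k; have [|F [U H]] := aA k (e / 2 / (2 ^ k.+1)%:R).
    by rewrite divr_gt0// ltr0n expn_gt0.
  by exists (F, U).
pose F n : set Omega := \bigcup_(k < n) (FU k).1.
pose U : set Omega := \bigcup_k (FU k).2.
have cF n : closed (F n).
  by apply: closed_bigcup => // k _; have [] := FUP k.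
have oU : open U by apply: bigcup_open => k _; have [] := FUP k.
have mD n : measurable ((U `\` F n) : set (borel Omega)).
  by rewrite setDE; apply: open_borel; apply: openI => //; exact: closed_openC.
have mk k : measurable (((FU k).2 `\` (FU k).1) : set (borel Omega)).
  have [? ? _ _ _] := FUP k.
  by rewrite setDE; apply: open_borel; apply: openI => //; exact: closed_openC.
have [n mn] : exists n, (m ((U `\` F n) : set (borel Omega)) < e%:E)%E.
  apply: measure_bigcap_lt => //.
    move=> i j ij; apply/subsetPset => x [Ux Fx]; split => // -[k /= ki Fkx].
    by apply: Fx; exists k => //=; exact: leq_trans ij.
  apply: (@le_lt_trans _ _ (e / 2)%:E); last first.
    by rewrite lte_fin ltr_pdivrMr// ltr_pMr// ltr1n.
  apply: le_trans (epsilon_trick0 xpredT (ltW e20)).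
  apply: (@le_trans _ _ (\sum_(k <oo) m ((FU k).2 `\` (FU k).1))%E).
    apply: measure_sigma_subadditive => //; first exact: bigcapT_measurable.
    move=> x Ux; have [[k _ Ukx] _] := Ux 0%N I; exists k => //; split => // Fkx.
    by have [_] := Ux k.+1 I; apply; exists k => /=.
  by apply: lee_nneseries => // k _; have [_ _ _ _ /ltW] := FUP k.
exists (F n), U; split => //.
- by move=> x [k _ Fkx]; exists k => //; have [_ _ + _ _] := FUP k; apply.
- by move=> x [k _ Akx]; exists k => //; have [_ _ _ + _] := FUP k; apply.
Qed.

Lemma measurable_approx (A : set (borel Omega)) :
  measurable A -> closed_open_approx A.
Proof.
apply: smallest_sub => [|B oB]; last exact: open_approx.
split.
- by apply: open_approx; exact: open0.
- by move=> B aB; rewrite setTD; exact: setC_approx.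
- exact: bigcup_approx.
Qed.

End regularity.

Lemma finite_measure_outer_regular (R : realType) (Omega : pointedMetricType R)
    (m : {measure set (borel Omega) -> \bar R}) (A : set (borel Omega)) :
  (m setT < +oo)%E -> measurable A ->
  m A = ereal_inf [set m U | U in [set U : set Omega | open U /\ A `<=` U]].
Proof.
move=> m_fin mA; apply/eqP; rewrite eq_le; apply/andP; split.
  apply: le_ereal_inf_tmp => _ [U [oU AU] <-].
  by apply: le_measure => //; rewrite inE//; exact: open_borel.
apply/lee_addgt0Pr => e e0.
have [F [U [cF oU FA AU mUF]]] := measurable_approx m_fin mA e0.
apply: ge_ereal_inf; exists (m U); first by exists U.
have mU : measurable (U : set (borel Omega)) by exact: open_borel.
have mF : measurable (F : set (borel Omega)) by exact: closed_borel.
rewrite -(setDUK AU) (le_trans (measureU2 _ _ _))//; first exact: measurableD.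
rewrite leeD2l// (le_trans _ (ltW mUF))//.
by apply: le_measure; rewrite ?inE//;
  [exact: measurableD|exact: measurableD|exact: setDS].
Qed.

(** In a compact metric space compact sets and closed sets coincide. *)
Lemma finite_measure_inner_regular (R : realType) (Omega : pointedMetricType R)
    (m : {measure set (borel Omega) -> \bar R}) (A : set (borel Omega)) :
  (m setT < +oo)%E -> compact [set: Omega] -> measurable A ->
  m A = ereal_sup [set m C | C in [set C : set Omega | compact C /\ C `<=` A]].
Proof.
move=> m_fin Oc mA; apply/eqP; rewrite eq_le; apply/andP; split; last first.
  apply: ge_ereal_sup => _ [C [cC CA] <-].
  apply: le_measure => //; rewrite inE//; apply: closed_borel.
  by apply: compact_closed cC; exact: metric_hausdorff.
apply/lee_addgt0Pr => e e0.
have [F [U [cF oU FA AU mUF]]] := measurable_approx m_fin mA e0.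
have mU : measurable (U : set (borel Omega)) by exact: open_borel.
have mF : measurable (F : set (borel Omega)) by exact: closed_borel.
apply: (@le_trans _ _ (m F + e%:E)%E).
  rewrite -{1}(setDUK FA) (le_trans (measureU2 _ _ _))//.
    exact: measurableD.
  rewrite leeD2l// (le_trans _ (ltW mUF))//.
  by apply: le_measure; rewrite ?inE//;
    [exact: measurableD|exact: measurableD|exact: setSD].
rewrite leeD2r//; apply: ereal_sup_ubound; exists F => //; split => //.
exact: subclosed_compact cF Oc _.
Qed.

(** The total variation of a signed measure is the sum of its Jordan parts, hence
    a finite measure. *)
Lemma regular_charge_compact (R : realType) (Omega : pointedMetricType R)
    (nu : {charge set (borel Omega) -> \bar R}) :
  compact [set: Omega] -> regular_charge nu.
Proof.
move=> Oc A mA.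
pose m := measure_add (jordan_pos (hahnP nu)) (jordan_neg (hahnP nu)).
have -> : abs_charge nu = m.
  by apply/funext => B; rewrite /m /abs_charge /charge_variation measure_addE.
have m_fin : (m setT < +oo)%E.
  by rewrite /m measure_addE -ge0_fin_numE ?adde_ge0// fin_numD !fin_num_measure.
split; first exact: finite_measure_outer_regular.
exact: finite_measure_inner_regular.
Qed.

(** * Signed measures that are differences of two finite measures *)

(** If p and n are the Jordan parts of nu = m1 - m2, then m1 + n = m2 + p; both
    sides are measures, so the integrals of f against them agree. *)
Lemma charge_integral_sub (R : realType) (Omega : pointedMetricType R)
    (m1 m2 : {finite_measure set (borel Omega) -> \bar R})
    (nu : {charge set (borel Omega) -> \bar R}) (f : borel Omega -> R) :
  (forall A, measurable A -> nu A = (m1 A - m2 A)%E) -> bounded_measurable f ->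
  charge_integral nu f = \int[m1]_x f x - \int[m2]_x f x.
Proof.
move=> nuE bf; rewrite /charge_integral.
set p := jordan_pos (hahnP nu); set n := jordan_neg (hahnP nu).
suff : \int[measure_add m1 n]_x f x = \int[measure_add m2 p]_x f x.
  rewrite !Rintegral_measure_add// => h; lra.
congr fine; apply: eq_measure_integral => A mA _.
have jordanE : (m1 A - m2 A = p A - n A)%E.
  by rewrite -nuE// [LHS](jordan_decomp (hahnP nu) mA) /cadd/= cscaleN1.
transitivity (m1 A + n A)%E; first exact: measure_addE.
transitivity (m2 A + p A)%E; last exact/esym/measure_addE.
have fin (m : {finite_measure set (borel Omega) -> \bar R}) : m A \is a fin_num.
  exact: fin_num_measure.
move: jordanE (fin m1) (fin m2) (fin p) (fin n).
case: (m1 A) => [a| |]//; case: (m2 A) => [b| |]//.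
case: (p A) => [x| |]//; case: (n A) => [y| |]// [h] _ _ _ _.
by rewrite -!EFinD; congr EFin; lra.
Qed.

Lemma charge_energy_sub (R : realType) (Omega : pointedMetricType R)
    (K : Omega -> Omega -> R)
    (m1 m2 : {finite_measure set (borel Omega) -> \bar R})
    (nu : {charge set (borel Omega) -> \bar R}) :
  compact [set: Omega] -> kernel_function K ->
  (forall A, measurable A -> nu A = (m1 A - m2 A)%E) ->
  charge_energy K nu =
    energy K m1 - 2 * mutual_energy K m1 m2 + energy K m2.
Proof.
move=> Oc Kk nuE; rewrite /charge_energy.
have -> : (fun x => charge_integral nu (fun y => K x y)) =
    (fun x => 1 * potential K m1 x + -1 * potential K m2 x).
  apply/funext => x; rewrite (charge_integral_sub nuE); last first.
    exact: bounded_measurable_kernel.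
  by rewrite mul1r mulN1r.
have b1 : bounded_measurable (potential K m1).
  exact: bounded_measurable_potential.
have b2 : bounded_measurable (potential K m2).
  exact: bounded_measurable_potential.
rewrite (charge_integral_sub nuE); last first.
  by apply: bounded_measurableD; exact: bounded_measurableZ.
rewrite !Rintegral_lincomb// -/(mutual_energy K m1 m2) -/(mutual_energy K m2 m1).
rewrite (mutual_energyC Oc Kk m2 m1) /energy; ring.
Qed.

(** The right-hand side is the energy of nu - mu, a signed measure of total
    mass 0. *)
Lemma conditionally_positive_definite_probability (R : realType)
    (Omega : pointedMetricType R) (K : Omega -> Omega -> R)
    (mu nu : probability (borel Omega) R) :
  compact [set: Omega] -> kernel_function K ->
  conditionally_positive_definite K ->
  0 <= energy K nu - 2 * mutual_energy K nu mu + energy K mu.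
Proof.
move=> Oc Kk cpd.
pose d := cadd (charge_of_finite_measure nu)
               (cscale (-1) (charge_of_finite_measure mu)).
have dE A : measurable A -> d A = (nu A - mu A)%E.
  by move=> _; rewrite /d /cadd/= /cscale EFinN mulN1e.
rewrite -(charge_energy_sub Oc Kk dE); apply: cpd.
  exact: regular_charge_compact.
by apply: (etrans (dE _ measurableT)); rewrite !probability_setT subee.
Qed.

(** * Local minimality along a segment *)

Lemma ge0_of_quadratic_near0 (R : realFieldType) (tau a c : R) : 0 < tau ->
  (forall t, 0 <= t -> t <= tau -> 0 <= 2 * t * a + t ^+ 2 * c) -> 0 <= a.
Proof.
move=> tau0 H; rewrite leNgt; apply/negP => a0.
have c0 : 0 < `|c| + 1 by rewrite ltr_wpDl.
(* This t makes the quadratic term at most half of the size of the linear one;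
   the 1 avoids a division by 0. *)
pose t := Num.min tau (- a / (`|c| + 1)).
have t0 : 0 < t by rewrite lt_min tau0 divr_gt0// oppr_gt0.
have tc : t * c <= - a.
  apply: (@le_trans _ _ (t * (`|c| + 1))).
    by rewrite ler_pM2l// (le_trans (ler_norm c))// lerDl.
  by rewrite -ler_pdivlMr// ge_min lexx orbT.
have := H t (ltW t0); rewrite ge_min lexx => /(_ isT).
rewrite (_ : _ + _ = t * (2 * a + t * c)); last by ring.
rewrite pmulr_rge0// => h; lra.
Qed.

Lemma local_minimizer_quadratic (R : realType) (Omega : pointedMetricType R)
    (K : Omega -> Omega -> R) (mu nu : probability (borel Omega) R) :
  compact [set: Omega] -> kernel_function K -> local_minimizer K mu ->
  exists tau : R, 0 < tau /\ forall t : R, 0 <= t -> t <= tau ->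
    0 <= 2 * t * (mutual_energy K nu mu - energy K mu) +
         t ^+ 2 * (energy K nu - 2 * mutual_energy K nu mu + energy K mu).
Proof.
move=> Oc Kk /(_ nu)[tau [tau0 tau1 mu_tau]]; exists tau; split => // t t0 t_tau.
have := mu_tau (Itv01 t0 (le_trans t_tau tau1)) t_tau.
rewrite energy_mixture//= -subr_ge0; congr (_ <= _); ring.
Qed.

(** * Local minimizers are global *)

Theorem proposition3p8 (R : realType) (Omega : pointedMetricType R)
    (Omega_compact : compact [set: Omega])
    (K : Omega -> Omega -> R) (K_kernel : kernel_function K)
    (mu : probability (borel Omega) R) (mu_local : local_minimizer K mu)
    (mu_K : invariant_measure K mu \/ conditionally_positive_definite K) :
  global_minimizer K mu.
Proof.
move=> nu.
have [tau [tau0 quad]] :=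
  local_minimizer_quadratic nu Omega_compact K_kernel mu_local.
have [mu_inv|cpd] := mu_K.
  have mutualE : mutual_energy K nu mu = energy K mu.
    rewrite /mutual_energy; under eq_Rintegral do rewrite mu_inv.
    by rewrite Rintegral_cst// [X in fine X](probability_setT nu) mulr1.
  have := quad tau (ltW tau0) (lexx _); rewrite mutualE subrr mulr0 add0r.
  rewrite pmulr_rge0 ?exprn_gt0// => h; lra.
have mutual_ge := ge0_of_quadratic_near0 tau0 quad.
have Q_ge0 := conditionally_positive_definite_probability mu nu
  Omega_compact K_kernel cpd.
lra.
Qed.
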